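(* Let $X\subset\mathbb{R}^n$ be a convex and closed semialgebraic set. Let $f\in\mathbb{R}[x]$, $x=(x_1,\dots,x_n)$, be a polynomial of degree $d>0$ whose leading form $f_d$ satisfies $f_{d*}:=\inf\{f_d(x):x\in\mathbb{R}^n,\ |x|=1\}>0$, and assume that there is $m>0$ with $f(x)\ge m$ for all $x\in X$. Let $N\ge 1$ be a real number such that for every $\xi\in\mathbb{R}^n$ the function $\varphi_{N,\xi}(x)=e^{N|x-\xi|^2}f(x)$ is strongly convex on $X$. Let $a_0\in X$ and let $(a_\nu)$ be the sequence defined by $a_\nu:=\operatorname{argmin}_X\varphi_{N,a_{\nu-1}}$ for $\nu\ge1$. Then the limit $a_*=\lim_{\nu\to\infty}a_\nu$ exists and $a_*\in\Sigma_Xf$.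
   Context: $|\cdot|$ is the Euclidean norm on $\mathbb{R}^n$. The leading form $f_d$ of a polynomial $f$ of degree $d$ is its homogeneous component of degree $d$. A function $\varphi$ is strongly convex on a convex set $X$ if for some $\mu>0$ the function $\varphi(x)-\frac{\mu}{2}|x|^2$ is convex on $X$. $\operatorname{argmin}_X\varphi$ denotes the unique point of $X$ at which the strongly convex function $\varphi$ attains its minimum on $X$. $\Sigma_Xf$ denotes the set of lower critical points of $f$ on $X$: for convex $X$ these are the points $a\in X$ with $\langle\nabla f(a),x-a\rangle\ge 0$ for all $x\in X$. *)

(* Defs.v *)
From mathcomp Require Import all_boot all_order all_algebra.
From mathcomp Require Import all_classical all_reals all_analysis.
(* Only the structures of [mpoly] are imported: its notations clash with those of
   MathComp-Analysis. *)
From mathcomp Require mpoly.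
Export (canonicals, coercions) mpoly.

Set Implicit Arguments.
Unset Strict Implicit.
Unset Printing Implicit Defensive.

Import Order.TTheory GRing.Theory Num.Theory numFieldNormedType.Exports.

Local Open Scope classical_set_scope.
Local Open Scope ring_scope.

Section Defs.
Context (R : realType) (n : nat).
Implicit Types (x y a xi : 'rV[R]_n) (X : set 'rV[R]_n).
Implicit Types (f : mpoly.mpoly n R) (phi : 'rV[R]_n -> R).

Definition dot x y : R := \sum_(i < n) x 0 i * y 0 i.

(* The library norm [`|x|] on ['rV[R]_n] is the max norm, hence this one;
   both induce the same topology. *)
Definition enorm x : R := Num.sqrt (dot x x).

Definition polyfun f : 'rV[R]_n -> R := fun x => mpoly.meval (x 0) f.

(* Homogeneous component of degree [deg f] ([msize] is the degree plus one). *)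
Definition leading_form f : mpoly.mpoly n R :=
  mpoly.pihomog (@mpoly.mdeg n) (mpoly.msize f).-1 f.

(* Infimum over the unit sphere. For [n = 0] the sphere is empty and [inf] takes
   its default value 0, but then no polynomial has positive degree. *)
Definition inf_sphere phi : R := inf [set phi x | x in [set x | enorm x = 1]].

(* Finite unions of sets {p = 0 for p in c.1, q > 0 for q in c.2}. *)
Definition semialgebraic X : Prop :=
  exists s : seq (seq (mpoly.mpoly n R) * seq (mpoly.mpoly n R)),
    X = [set x | has (fun c => all (fun p => polyfun p x == 0) c.1
                               && all (fun q => 0 < polyfun q x) c.2) s].

Definition strongly_convex X phi : Prop :=
  exists2 mu : R, 0 < mu &
    convex_function X (fun x => phi x - mu / 2 * enorm x ^+ 2).

(* The point of [X] where [phi] attains its minimum on [X]; [get] returns an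
   arbitrary default value when there is no such point. *)
Definition argmin X phi : 'rV[R]_n :=
  get [set a | X a /\ forall x, X x -> phi a <= phi x].

Definition grad phi a : 'rV[R]_n := \row_(i < n) 'D_(delta_mx 0 i) phi a.

Definition lower_critical X phi : set 'rV[R]_n :=
  [set a | X a /\ forall x, X x -> 0 <= dot (grad phi a) (x - a)].

Definition exp_conv (N : R) xi f : 'rV[R]_n -> R :=
  fun x => expR (N * enorm (x - xi) ^+ 2) * polyfun f x.

End Defs.

(* Main.v *)
Require Import Defs.
From HB Require Import structures.
From mathcomp Require Import all_boot all_order all_algebra.
From mathcomp Require Import all_classical all_reals all_analysis.
From mathcomp Require mpoly.
From mathcomp.real_closed Require polyrcf ordered_qelim qe_rcf.
From mathcomp Require Import ring lra.

Set Implicit Arguments.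
Unset Strict Implicit.
Unset Printing Implicit Defensive.

Import Order.TTheory GRing.Theory Num.Theory numFieldNormedType.Exports.

Local Open Scope classical_set_scope.
Local Open Scope ring_scope.

(** The objective [exp (N |x - xi|^2) f x] is minimal at [p]; comparing its values
    at [p] and at [x] and using [1 + s <= exp s] gives, for every [x] in [X],

      [f x >= f p (1 - N (2 <p - xi, x - p> + |x - p|^2))].

    Everything rests on this inequality ([argmin_proximal]).  With [xi] and [p] two
    consecutive iterates and [D_nu = |a_(nu+1) - a_nu|] it says two things: the value
    of [f] drops by at least a multiple of [D_nu^2] ([proximal_descent]), and at
    [a_(nu+1)] the function [f] decreases along [X] at rate at most a multiple of
    [D_nu], up to a uniform quadratic error ([proximal_slope]).

    Convergence follows from a bound on the sum of the [D_nu], where semialgebraicity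
    enters.  Over each value [t] of [f] choose a pair [gamma t = (r, x)], where [x] is
    a point of [X] with [f x = t] at which the rate [r] of decrease is the least
    possible, ties being broken by the lexicographic order.  This choice is definable
    in the ordered field of the reals.  By quantifier elimination the truth value of
    [s < gamma_j t] changes, as [t] decreases, a number of times that is bounded
    independently of [s] ([definable_switches]); integrating over [s], the curve [gamma]
    has finite length along every decreasing sequence of values
    ([definable_selection]).

    Let [G_nu] be the distance from [gamma (f a_(nu+1))] to [gamma (f a_(nu+2))].  The
    rate selected at the first of these two levels is at most that of [a_(nu+1)],
    hence of order [D_nu], so

      [D_(nu+1)^2 <= O (f a_(nu+1) - f a_(nu+2)) <= O (D_nu G_nu + G_nu^2)],

    whence [D_(nu+1) <= D_nu / 2 + O (G_nu)].  As the [G_nu] are summable, so are the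
    [D_nu] ([proximal_finite_length]), and the iterates converge.  The growth of the
    leading form makes the sublevel sets of [f] bounded ([polyfun_coercive]), hence
    compact the sets of pairs among which [gamma] selects.

    At the limit [a], the displayed inequality becomes
    [f x >= f a - N f a |x - a|^2] on [X]: along a segment of [X] starting at [a] the
    right derivative of [f] cannot be negative ([limit_lower_critical]). *)

(** * Sign changes of one-variable definable predicates *)

Section switch_points.
Context (R : rcfType).
Implicit Types (P Q : R -> bool) (M : nat).

(** Listing points that meet every interval on which [P] is not constant, rather than
    counting changes of value, makes the notion stable under Boolean operations by
    concatenation of the lists. *)
Definition switches_at_most M P : Prop :=
  exists rs : seq R, (size rs <= M)%N /\
    forall t t', t < t' -> P t != P t' -> exists2 rho, rho \in rs & t <= rho <= t'.

Lemma switches_cst b : switches_at_most 0 (fun=> b).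
Proof. by exists [::]; split => // t t' _; rewrite eqxx. Qed.

Lemma switches_ext M P Q :
  P =1 Q -> switches_at_most M P -> switches_at_most M Q.
Proof.
by move=> PQ [rs [sz h]]; exists rs; split => // t t'; rewrite -!PQ; exact: h.
Qed.

Lemma switches_neg M P : switches_at_most M P -> switches_at_most M (predC P).
Proof.
move=> [rs [sz h]]; exists rs; split => // t t' tt' /=.
by rewrite (inj_eq negb_inj); exact: h.
Qed.

Lemma switches_op2 (op : bool -> bool -> bool) M N P Q :
  switches_at_most M P -> switches_at_most N Q ->
  switches_at_most (M + N) (fun t => op (P t) (Q t)).
Proof.
move=> [rs [szr hr]] [ss [szs hs]]; exists (rs ++ ss); split.
  by rewrite size_cat leq_add.
move=> t t' tt'; case: (eqVneq (P t) (P t')) => [-> | nP _]; last first.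
  by have [rho rhoin ?] := hr _ _ tt' nP; exists rho; rewrite // mem_cat rhoin.
case: (eqVneq (Q t) (Q t')) => [-> | nQ _]; first by rewrite eqxx.
by have [rho rhoin ?] := hs _ _ tt' nQ; exists rho; rewrite // mem_cat rhoin orbT.
Qed.

(** Between two consecutive roots a polynomial has constant sign, so its roots serve as
    the listed points; the bound depends on the degree only. *)
Lemma switches_poly (op : R -> bool) (p : {poly R}) :
  (forall x y, Num.sg x = Num.sg y -> op x = op y) ->
  switches_at_most (size p) (fun t => op p.[t]).
Proof.
move=> opsg; case: (eqVneq p 0) => [->|p0].
  by rewrite size_poly0; apply: switches_ext (switches_cst (op 0)) => t; rewrite horner0.
exists (polyrcf.rootsR p); split.
  have roots_root : all (root p) (polyrcf.rootsR p).
    by apply/allP => x; exact: polyrcf.root_roots.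
  exact: ltnW (max_poly_roots p0 roots_root (polyrcf.uniq_roots _ _ _)).
move=> t t' tt' neq.
have [//|no_rho] := pselect (exists2 rho, rho \in polyrcf.rootsR p & t <= rho <= t').
case/eqP: neq; apply: opsg.
have noroot : {in `[t, t'], forall x, ~~ root p x}.
  move=> x; rewrite in_itv/= => xt; apply/negP => px; apply: no_rho; exists x => //.
  by have := polyrcf.roots_on_rootsR p0 x; rewrite in_itv /= px => <-.
have tin : t \in `[t, t'] by rewrite in_itv /= lexx ltW.
have t'in : t' \in `[t, t'] by rewrite in_itv /= lexx ltW.
exact: (polyrcf.polyrN0_itv noroot t'in tin).
Qed.

Import qe_rcf (abstrX, abstrXP, to_rterm, to_rtermE, evalE, eval_poly, eval_polyP).

(** As a polynomial in the [i]-th variable, a term has a degree bounded by its syntax: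
    this is why the bound is uniform in the values [e] of the other variables. *)
Lemma switches_term (op : R -> bool) (t : GRing.term R) i :
  (forall x y, Num.sg x = Num.sg y -> op x = op y) -> GRing.rterm t ->
  exists M, forall e, switches_at_most M (fun x => op (GRing.eval (set_nth 0 e i x) t)).
Proof.
move=> opsg rt; exists (size (abstrX i (to_rterm t))) => e.
pose p := eval_poly e (abstrX i (to_rterm t)).
have szp : (size p <= size (abstrX i (to_rterm t)))%N.
  by rewrite /p eval_polyP (leq_trans (size_Poly _)) // size_map.
have [rs [szr hr]] := switches_poly p opsg.
exists rs; split; first exact: leq_trans szp.
move=> x y xy; have evE z : GRing.eval (set_nth 0 e i z) t = p.[z].
  by rewrite /p abstrXP evalE to_rtermE.
by rewrite !evE; exact: hr.
Qed.

Lemma switches_qf (F : ordered_qelim.ord.formula R) i :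
  ordered_qelim.ord.qf_form F -> ordered_qelim.ord.rformula F ->
  exists M, forall e,
    switches_at_most M (fun x => ordered_qelim.ord.qf_eval (set_nth 0 e i x) F).
Proof.
have atom op (t1 t2 : GRing.term R) :
    (forall x y, Num.sg x = Num.sg y -> op x = op y) ->
    GRing.rterm t1 && GRing.rterm t2 -> exists M, forall e, switches_at_most M
      (fun x => op (GRing.eval (set_nth 0 e i x) (GRing.Add t1 (GRing.Opp t2)))).
  by move=> opsg r12; exact: switches_term.
elim: F => //=.
- by move=> b _ _; exists 0%N => e; exact: switches_cst.
- move=> t1 t2 _ r12; have [|M h] := atom (fun x => x == 0) t1 t2 _ r12.
    by move=> x y xy; rewrite -(sgr_eq0 x) -(sgr_eq0 y) xy.
  by exists M => e; apply: switches_ext _ (h e) => x; rewrite [LHS]subr_eq0.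
- move=> t1 t2 _ r12; have [|M h] := atom (fun x => x < 0) t1 t2 _ r12.
    by move=> x y xy; rewrite -(sgr_lt0 x) -(sgr_lt0 y) xy.
  by exists M => e; apply: switches_ext _ (h e) => x; rewrite [LHS]subr_lt0.
- move=> t1 t2 _ r12; have [|M h] := atom (fun x => x <= 0) t1 t2 _ r12.
    by move=> x y xy; rewrite -(sgr_le0 x) -(sgr_le0 y) xy.
  by exists M => e; apply: switches_ext _ (h e) => x; rewrite [LHS]subr_le0.
- move=> F1 IH1 F2 IH2 /andP[q1 q2] /andP[r1 r2].
  have [M1 h1] := IH1 q1 r1; have [M2 h2] := IH2 q2 r2.
  by exists (M1 + M2)%N => e; exact: switches_op2.
- move=> F1 IH1 F2 IH2 /andP[q1 q2] /andP[r1 r2].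
  have [M1 h1] := IH1 q1 r1; have [M2 h2] := IH2 q2 r2.
  by exists (M1 + M2)%N => e; exact: switches_op2.
- move=> F1 IH1 F2 IH2 /andP[q1 q2] /andP[r1 r2].
  have [M1 h1] := IH1 q1 r1; have [M2 h2] := IH2 q2 r2.
  by exists (M1 + M2)%N => e; exact: (switches_op2 implb).
- move=> F1 IH1 q1 r1; have [M1 h1] := IH1 q1 r1.
  by exists M1 => e; exact: switches_neg.
Qed.

(** Quantifier elimination reduces to [switches_qf].  The uniformity in the parameters
    [e] is what the bound on lengths will need. *)
Lemma switches_formula (F : ordered_qelim.ord.formula R) i :
  exists M, forall e,
    switches_at_most M (fun x => `[< ordered_qelim.ord.holds (set_nth 0 e i x) F >]).
Proof.
set G := ordered_qelim.ord.quantifier_elim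
  (fun i bc => qe_rcf.qfr_to_formula (@qe_rcf.wproj R i bc)) (ordered_qelim.ord.to_rform F).
have /andP[qG rG] := ordered_qelim.ord.quantifier_elim_wf (@qe_rcf.wf_QE_wproj R)
  (ordered_qelim.ord.to_rform_rformula F).
have [M h] := switches_qf i qG rG.
exists M => e; apply: switches_ext (h e) => x.
by apply/idP/asboolP => [/qe_rcf.rcf_satP|/qe_rcf.rcf_satP].
Qed.

(** Each listed point is met by at most two of the steps of a monotone sequence, one
    ending at it and one starting from it: hence the factor two. *)
Lemma count_switches_le M P (t : nat -> R) K :
  switches_at_most M P -> (forall i, t i.+1 <= t i) ->
  (\sum_(i < K) (P (t i) != P (t i.+1)) <= M.*2)%N.
Proof.
move=> [rs [szr hr]] tdec.
(* [below] counts the listed points below [u] with weight two and a point equal to [u]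
   with weight one: it drops at every step at which [P] changes. *)
pose below u := (\sum_(rho <- rs) ((rho <= u)%R + (rho < u)%R))%N.
have step i : ((P (t i) != P (t i.+1)) + below (t i.+1) <= below (t i))%N.
  pose crossed rho := (t i.+1 < t i) && (t i.+1 <= rho <= t i).
  have : ((P (t i) != P (t i.+1)) <= \sum_(rho <- rs) crossed rho)%N.
    case: eqVneq => //= neq.
    have lti : t i.+1 < t i.
      by rewrite lt_neqAle tdec andbT; apply: contraNneq neq => ->.
    rewrite eq_sym in neq; have [rho rhoin rhob] := hr _ _ lti neq.
    by rewrite (big_rem rho) //= {1}/crossed lti rhob.
  rewrite -(leq_add2r (below (t i.+1))) => /leq_trans; apply.
  rewrite -big_split /=; apply: leq_sum => rho _; rewrite /crossed.
  have := tdec i; case: (ltgtP rho (t i)); case: (ltgtP rho (t i.+1)) => //=;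
    rewrite ?andbF ?andbT ?addn0 //; try by move=> _ _ _; case: (_ < _).
  - by move=> *; lra.
  - by move=> *; lra.
  - by move=> *; lra.
  - by move=> -> <-; rewrite ltxx.
have main : (\sum_(i < K) (P (t i) != P (t i.+1)) + below (t K) <= below (t 0%N))%N.
  elim: K => [|K IH]; first by rewrite big_ord0.
  rewrite big_ord_recr /= -addnA (leq_trans _ IH) // leq_add2l; exact: step.
apply: leq_trans (leq_trans (leq_addr _ _) main) _.
rewrite /below -addnn; apply: (@leq_trans (\sum_(rho <- rs) 2)).
  by apply: leq_sum => rho _; case: (_ <= _); case: (_ < _).
by rewrite big_const_seq count_predT iter_addn_0 mul2n -addnn leq_add.
Qed.

End switch_points.

(** * Variation of a sequence and crossings of levels *)

Section variation.
Context (R : realFieldType).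

(** Discrete form of [x = integral of the indicator of (s < x) in s], with the level
    [s] running through the gaps of a sorted list that contains [x]. *)
Lemma layer_cake (s : seq R) (x : R) : sorted <=%R s -> x \in s ->
  x - nth 0 s 0 = \sum_(j < (size s).-1) (nth 0 s j.+1 - nth 0 s j) * (nth 0 s j < x)%R%:R.
Proof.
move=> ss xs.
have le_nth i j : (i <= j < size s)%N -> nth 0 s i <= nth 0 s j.
  move=> /andP[ij js]; apply: (sorted_leq_nth le_trans) => //.
  by rewrite inE (leq_ltn_trans ij).
have szs : (0 < size s)%N by case: (s) xs.
have [l ls xE] : exists2 l, (l < size s)%N & x = nth 0 s l.
  by exists (index x s); rewrite ?index_mem ?nth_index.
have -> : x - nth 0 s 0 = Num.min (nth 0 s (size s).-1) x - Num.min (nth 0 s 0%N) x.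
  have x0 : nth 0 s 0 <= x by rewrite xE le_nth.
  have xl : x <= nth 0 s (size s).-1 by rewrite xE le_nth // -ltnS prednK // ls leqnn.
  by rewrite (min_r xl) (min_l x0).
rewrite -(telescope_sumr (fun j => Num.min (nth 0 s j) x)) // big_mkord.
apply: eq_bigr => -[j jlt] _ /=.
have jS : (j.+1 < size s)%N by rewrite -ltn_predRL.
have := le_nth j j.+1; rewrite leqnSn jS => /(_ isT) ltj.
have [jl|lj] := ltnP j l.
  have : nth 0 s j.+1 <= x by rewrite xE le_nth // jl ls.
  move=> jx; rewrite !min_l //; last exact: le_trans jx.
  by have [?|] := ltP; rewrite ?mulr1 // mulr0; lra.
have xj : x <= nth 0 s j by rewrite xE le_nth // lj ltnW.
by rewrite !min_r ?(le_trans xj) // subrr ltNge xj mulr0.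
Qed.

(** The variation is the integral over all levels [s] of the number of crossings of
    [s]; here all the levels lying in one gap between the values of [x] are crossed
    equally often, so a finite sum replaces the integral. *)
Lemma variation_le M (x : nat -> R) K A B :
  (forall i, A <= x i <= B) ->
  (forall s, (\sum_(i < K) ((s < x i)%R != (s < x i.+1)%R) <= M)%N) ->
  \sum_(i < K) `|x i.+1 - x i| <= M%:R * (B - A).
Proof.
move=> xAB sw.
pose s := sort <=%R [seq x i | i <- iota 0 K.+1].
have ss : sorted <=%R s by apply: sort_sorted; exact: le_total.
have xs i : (i <= K)%N -> x i \in s.
  by move=> iK; rewrite mem_sort; apply: map_f; rewrite mem_iota.
have szs : size s = K.+1 by rewrite size_sort size_map size_iota.
have sAB j : (j <= K)%N -> A <= nth 0 s j <= B.
  move=> jK; have : nth 0 s j \in s by rewrite mem_nth // szs ltnS.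
  by rewrite mem_sort => /mapP[i _ ->].
pose w j := nth 0 s j.+1 - nth 0 s j.
have w0 j : (j < K)%N -> 0 <= w j.
  move=> jK; rewrite subr_ge0; apply: (sorted_leq_nth le_trans) => //.
  - by rewrite inE szs ltnS ltnW.
  - by rewrite inE szs ltnS.
apply: (@le_trans _ _ (\sum_(i < K) \sum_(j < K)
    w j * ((nth 0 s j < x i)%R != (nth 0 s j < x i.+1)%R)%:R)).
  apply: ler_sum => -[i iK] _ /=.
  have -> : x i.+1 - x i = (x i.+1 - nth 0 s 0) - (x i - nth 0 s 0) by lra.
  rewrite !layer_cake ?xs // ?(ltnW iK) // szs /= -sumrB.
  apply: le_trans (ler_norm_sum _ _ _) _; apply: ler_sum => -[j jK] _ /=.
  rewrite -mulrBr normrM ger0_norm ?w0 // ler_wpM2l ?w0 //.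
  by case: (_ < _); case: (_ < _); rewrite /= ?subrr ?subr0 ?sub0r ?normrN ?normr0 ?normr1.
rewrite exchange_big /=.
apply: (@le_trans _ _ (\sum_(j < K) w j * M%:R)).
  apply: ler_sum => -[j jK] _ /=; rewrite -mulr_sumr ler_wpM2l ?w0 //.
  by rewrite -natr_sum ler_nat sw.
rewrite -mulr_suml mulrC ler_wpM2l ?ler0n // -(big_mkord xpredT w) telescope_sumr //.
have /andP[_ ?] := sAB K (leqnn _); have /andP[? _] := sAB 0%N (leq0n _).
exact: lerB.
Qed.

End variation.

(** * Definable predicates on families of vectors *)

Section definable.
Context (R : realType) (k : nat).
Implicit Types (e : nat -> 'rV[R]_k) (P Q : (nat -> 'rV[R]_k) -> Prop).
Implicit Types (g h : (nat -> 'rV[R]_k) -> R).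

(** The variables of a formula are cut into blocks of [k] consecutive ones, so that a
    formula speaks of vectors: block [j] is the [j]-th vector variable. *)
Definition blocks (s : seq R) : nat -> 'rV[R]_k :=
  fun j => \row_(i < k) nth 0 s (j * k + i).

Definition definable P :=
  exists F : ordered_qelim.ord.formula R,
    forall s, ordered_qelim.ord.holds s F <-> P (blocks s).

Definition polynomial_fn g :=
  exists T : GRing.term R, forall s, GRing.eval s T = g (blocks s).

Definition upd e j v : nat -> 'rV[R]_k := fun j' => if j' == j then v else e j'.

Lemma polynomial_cst c : polynomial_fn (fun=> c).
Proof. by exists (GRing.Const c). Qed.

Lemma polynomial_coord j i : polynomial_fn (fun e => e j 0 i).
Proof. by exists (GRing.Var _ (j * k + i)) => s; rewrite mxE. Qed.

Lemma polynomialD g h :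
  polynomial_fn g -> polynomial_fn h -> polynomial_fn (fun e => g e + h e).
Proof.
by move=> [G hG] [H hH]; exists (GRing.Add G H) => s; rewrite /= hG hH.
Qed.

Lemma polynomialM g h :
  polynomial_fn g -> polynomial_fn h -> polynomial_fn (fun e => g e * h e).
Proof.
by move=> [G hG] [H hH]; exists (GRing.Mul G H) => s; rewrite /= hG hH.
Qed.

Lemma polynomialB g h :
  polynomial_fn g -> polynomial_fn h -> polynomial_fn (fun e => g e - h e).
Proof.
by move=> [G hG] [H hH]; exists (GRing.Add G (GRing.Opp H)) => s; rewrite /= hG hH.
Qed.

Lemma polynomialX g m : polynomial_fn g -> polynomial_fn (fun e => g e ^+ m).
Proof. by move=> [G hG]; exists (GRing.Exp G m) => s; rewrite /= hG. Qed.

Lemma polynomial_sum (I : Type) (r : seq I) (g : I -> (nat -> 'rV[R]_k) -> R) :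
  (forall i, polynomial_fn (g i)) -> polynomial_fn (fun e => \sum_(i <- r) g i e).
Proof.
move=> pg; elim: r => [|i r IH].
  by under eq_fun do rewrite big_nil; exact: polynomial_cst.
by under eq_fun do rewrite big_cons; exact: polynomialD.
Qed.

Lemma polynomial_prod (I : Type) (r : seq I) (g : I -> (nat -> 'rV[R]_k) -> R) :
  (forall i, polynomial_fn (g i)) -> polynomial_fn (fun e => \prod_(i <- r) g i e).
Proof.
move=> pg; elim: r => [|i r IH].
  by under eq_fun do rewrite big_nil; exact: polynomial_cst.
by under eq_fun do rewrite big_cons; exact: polynomialM.
Qed.

Lemma polynomial_polyfun n (f : mpoly.mpoly n R) (y : (nat -> 'rV[R]_k) -> 'rV[R]_n) :
  (forall i, polynomial_fn (fun e => y e 0 i)) -> polynomial_fn (fun e => polyfun f (y e)).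
Proof.
move=> py; rewrite /polyfun; under eq_fun do rewrite mpoly.mevalE.
apply: polynomial_sum => m; apply: polynomialM (polynomial_cst _) _.
by apply: polynomial_prod => i; exact: polynomialX.
Qed.

Lemma definable_iff P Q : (forall e, P e <-> Q e) -> definable P -> definable Q.
Proof. by move=> PQ [F hF]; exists F => s; rewrite hF. Qed.

Lemma definable_le g h : polynomial_fn g -> polynomial_fn h -> definable (fun e => g e <= h e).
Proof.
by move=> [G hG] [H hH]; exists (ordered_qelim.ord.Le G H) => s; rewrite /= hG hH.
Qed.

Lemma definable_lt g h : polynomial_fn g -> polynomial_fn h -> definable (fun e => g e < h e).
Proof.
by move=> [G hG] [H hH]; exists (ordered_qelim.ord.Lt G H) => s; rewrite /= hG hH.
Qed.

Lemma definable_eq g h : polynomial_fn g -> polynomial_fn h -> definable (fun e => g e = h e).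
Proof.
by move=> [G hG] [H hH]; exists (ordered_qelim.ord.Equal G H) => s; rewrite /= hG hH.
Qed.

Lemma definable_cst (p : Prop) : definable (fun=> p).
Proof.
by exists (ordered_qelim.ord.Bool `[< p >]) => s /=; split => /asboolP.
Qed.

Lemma definable_and P Q : definable P -> definable Q -> definable (fun e => P e /\ Q e).
Proof.
by move=> [F hF] [G hG]; exists (ordered_qelim.ord.And F G) => s; rewrite /= hF hG.
Qed.

Lemma definable_imp P Q : definable P -> definable Q -> definable (fun e => P e -> Q e).
Proof.
by move=> [F hF] [G hG]; exists (ordered_qelim.ord.Implies F G) => s; rewrite /= hF hG.
Qed.

Lemma definable_not P : definable P -> definable (fun e => ~ P e).
Proof. by move=> [F hF]; exists (ordered_qelim.ord.Not F) => s; rewrite /= hF. Qed.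

Lemma definable_all (I : eqType) (r : seq I) (P : I -> (nat -> 'rV[R]_k) -> Prop) :
  (forall i, i \in r -> definable (P i)) -> definable (fun e => forall i, i \in r -> P i e).
Proof.
elim: r => [|j r IH] dP; first by apply: definable_iff (definable_cst Logic.True).
have dPr : definable (fun e => forall i, i \in r -> P i e).
  by apply: IH => i ir; apply: dP; rewrite inE ir orbT.
apply: definable_iff (definable_and (dP j (mem_head _ _)) dPr) => e.
split=> [[Pj Pr] i|Pr].
  by rewrite inE => /predU1P[->|/Pr].
by split=> [|i ir]; apply: Pr; rewrite inE ?eqxx ?ir ?orbT.
Qed.

Lemma definable_has (I : eqType) (r : seq I) (P : I -> (nat -> 'rV[R]_k) -> Prop) :
  (forall i, i \in r -> definable (P i)) ->
  definable (fun e => exists2 i, i \in r & P i e).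
Proof.
move=> dP; have := definable_not (definable_all (fun i ir => definable_not (dP i ir))).
apply: definable_iff => e.
split=> [/existsNP[i /not_implyP[ir /contrapT Pi]]|[i ir Pi] /(_ i ir)//].
by exists i.
Qed.

Lemma blocks_set_nth s j (i : 'I_k) x :
  blocks (set_nth 0 s (j * k + i) x) =
  upd (blocks s) j (\row_i' if i' == i then x else blocks s j 0 i').
Proof.
have k0 : (0 < k)%N := leq_ltn_trans (leq0n _) (ltn_ord i).
apply: funext => j'; apply/rowP => i'; rewrite /upd !mxE nth_set_nth /=.
have -> : (j' * k + i' == j * k + i)%N = (j' == j) && (i' == i).
  apply/eqP/andP => [E|[/eqP-> /eqP->]//].
  have := congr1 (divn^~ k) E; have := congr1 (modn^~ k) E.
  rewrite /= !modnMDl !divnMDl // !modn_small // !divn_small // !addn0.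
  by move=> Ei ->; split; apply/eqP => //; exact: val_inj.
by case: (eqVneq j' j) => [->|_] /=; rewrite !mxE.
Qed.

Lemma upd_upd e j v w : upd (upd e j v) j w = upd e j w.
Proof. by apply: funext => j'; rewrite /upd; case: eqP. Qed.

(** A quantifier over a vector is [k] nested quantifiers; [agree m] says that only the
    first [m] coordinates have been quantified so far. *)
Lemma definable_exists j P : definable P -> definable (fun e => exists v, P (upd e j v)).
Proof.
move=> dP.
pose agree m e (v : 'rV[R]_k) := forall i : 'I_k, (m <= i)%N -> v 0 i = e j 0 i.
suff H m : (m <= k)%N -> definable (fun e => exists v, agree m e v /\ P (upd e j v)).
  apply: definable_iff (H k (leqnn k)) => e; split=> [[v [_ Pv]]|[v Pv]]; exists v => //.
  by split => // i; rewrite leqNgt ltn_ord.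
elim: m => [_|m IH mk].
  apply: definable_iff dP => e; split=> [Pe|[v [vE]]].
    by exists (e j); split=> //; congr P: Pe; apply: funext => j'; rewrite /upd; case: eqP => [->|].
  congr P; apply: funext => j'; rewrite /upd; case: eqP => [->|] //.
  by apply/rowP => i; exact: vE.
have [F hF] := IH (ltnW mk).
exists (ordered_qelim.ord.Exists (j * k + m) F) => s /=; split=> [[x]|[v [vE Pv]]].
  rewrite hF => -[v [vE]]; have := blocks_set_nth s j (Ordinal mk) x => /= ->.
  rewrite upd_upd => Pv; exists v; split => // i mi.
  rewrite vE ?(ltnW mi) //; have := blocks_set_nth s j (Ordinal mk) x => /= ->.
  by rewrite /upd eqxx mxE; case: eqP => // E; move: mi; rewrite E /= ltnn.
exists (v 0 (Ordinal mk)); rewrite hF; exists v.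
have := blocks_set_nth s j (Ordinal mk) (v 0 (Ordinal mk)) => /= ->.
rewrite upd_upd; split=> // i mi; rewrite /upd eqxx mxE; case: eqP => [->//|/eqP ne].
by apply: vE; rewrite ltn_neqAle mi andbT eq_sym.
Qed.

Lemma definable_forall j P : definable P -> definable (fun e => forall v, P (upd e j v)).
Proof.
move=> dP; apply: definable_iff (definable_not (definable_exists j (definable_not dP))).
by move=> e; rewrite -forallNE; split=> H v; [apply: contrapT; exact: H | apply; exact: H].
Qed.

Lemma definable_semialgebraic n (X : set 'rV[R]_n)
    (y : (nat -> 'rV[R]_k) -> 'rV[R]_n) :
  semialgebraic X -> (forall i, polynomial_fn (fun e => y e 0 i)) ->
  definable (fun e => X (y e)).
Proof.
move=> [s ->] py.
have pf f := polynomial_polyfun f py; have p0 := polynomial_cst 0.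
have := @definable_has _ s (fun c e => (forall p, p \in c.1 -> polyfun p (y e) = 0) /\
  (forall q, q \in c.2 -> 0 < polyfun q (y e))).
move=> /(_ _)/definable_iff; apply.
  move=> e; split=> [[c cs [c1 c2]]|/hasP[c cs /andP[/allP c1 /allP c2]]].
    apply/hasP; exists c => //; apply/andP; split; apply/allP => // p pc.
    by apply/eqP; exact: c1.
  by exists c => //; split => // p pc; apply/eqP; exact: c1.
move=> c _; apply: definable_and; apply: definable_all => p _.
  exact: definable_eq.
exact: definable_lt.
Qed.

End definable.

Arguments definable R k P : clear implicits.
Arguments polynomial_fn R k g : clear implicits.

(** * Definable selections have finite length *)

Section selection.
Context (R : realType) (k : nat).
Implicit Types (A : set 'rV[R]_k.+1) (F : R -> set 'rV[R]_k.+1) (v w : 'rV[R]_k.+1).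

(** The first coordinates of the vectors 0 and 1 play the roles of the variable [t] and
    of the parameter [s]. *)
Lemma definable_switches (Q : R -> R -> Prop) :
  definable R k.+1 (fun e => Q (e 0%N 0 0) (e 1%N 0 0)) ->
  exists M, forall s, switches_at_most M (fun t => `[< Q t s >]).
Proof.
move=> [F hF]; have [M hM] := switches_formula F 0.
exists M => s; apply: switches_ext (hM (set_nth 0 [::] k.+1 s)) => t.
set s' := set_nth _ _ _ _.
suff -> : `[< Q t s >] = `[< Q (blocks k.+1 s' 0 0 0) (blocks k.+1 s' 1 0 0) >].
  exact/asbool_equiv_eq.
by rewrite !mxE mul0n mul1n !addn0 /s' !nth_set_nth /= nth_ncons ltnn subnn.
Qed.

(** Minimal points for the lexicographic order on the first [m] coordinates: for
    [m = k.+1] a definable choice of one point in a compact set. *)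
Fixpoint lexmin (m : nat) A : set 'rV[R]_k.+1 :=
  if m is m'.+1 then
    [set v | lexmin m' A v /\ forall w, lexmin m' A w -> v 0 (inord m') <= w 0 (inord m')]
  else A.

Lemma lexmin_sub m m' A : (m <= m')%N -> lexmin m' A `<=` lexmin m A.
Proof.
move=> /subnK <-; elim: (m' - m)%N => [//|d IH] v.
by rewrite addSn => -[/IH].
Qed.

Lemma lexmin_compact m A : compact A -> A !=set0 ->
  compact (lexmin m A) /\ lexmin m A !=set0.
Proof.
move=> cA A0; elim: m => [//|m [cL L0]] /=.
have cont : continuous (fun v : 'rV[R]_k.+1 => v 0 (inord m)).
  exact: coord_continuous.
have [c] := EVT_min_rV L0 cL (continuous_subspaceT cont).
rewrite inE => Lc minc; split; last by exists c; split => // w Lw; apply: minc; rewrite inE.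
have -> : [set v | lexmin m A v /\ forall w, lexmin m A w -> v 0 (inord m) <= w 0 (inord m)]
    = lexmin m A `&` [set v | v 0 (inord m) <= c 0 (inord m)].
  apply/seteqP; split=> v /= [Lv vmin]; split=> //.
    exact: vmin.
  by move=> w Lw; rewrite (le_trans vmin) // minc // inE.
apply: compact_closedI => //.
have := @closed_comp _ _ (fun v : 'rV[R]_k.+1 => v 0 (inord m)) [set x | x <= c 0 (inord m)].
by apply=> [v _|]; [exact: cont | exact: closed_le].
Qed.

Lemma lexmin_coord A v w (i : 'I_k.+1) :
  lexmin k.+1 A v -> lexmin k.+1 A w -> v 0 i = w 0 i.
Proof.
move=> /(lexmin_sub (ltn_ord i)) /= [Lv minv] /(lexmin_sub (ltn_ord i)) /= [Lw minw].
by apply/eqP; rewrite eq_le -[i]inord_val minv ?minw.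
Qed.

(** Formulas cannot be renamed as such, but [F] holds at the vector 2 exactly when it
    holds at some vector 1 equal to the vector 2. *)
Lemma definable_rename F : definable R k.+1 (fun e => F (e 0%N 0 0) (e 1%N)) ->
  definable R k.+1 (fun e => F (e 0%N 0 0) (e 2%N)).
Proof.
move=> dF.
have dE : definable R k.+1 (fun e => forall i, i \in enum 'I_k.+1 -> e 1%N 0 i = e 2%N 0 i).
  by apply: definable_all => i _; apply: definable_eq; exact: polynomial_coord.
apply: definable_iff (definable_exists 1 (definable_and dE dF)) => e.
split=> [[v [vE]]|Fe].
  have -> : v = e 2%N by apply/rowP => i; apply: vE; rewrite mem_enum.
  by [].
by exists (e 2%N).
Qed.

Lemma definable_lexmin m F : definable R k.+1 (fun e => F (e 0%N 0 0) (e 1%N)) ->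
  definable R k.+1 (fun e => lexmin m (F (e 0%N 0 0)) (e 1%N)).
Proof.
move=> dF; elim: m => //= m IH; apply: definable_and => //.
have dimp : definable R k.+1 (fun e => lexmin m (F (e 0%N 0 0)) (e 2%N) ->
    e 1%N 0 (inord m) <= e 2%N 0 (inord m)).
  apply: definable_imp; first exact: (@definable_rename (fun t => lexmin m (F t))).
  by apply: definable_le; exact: polynomial_coord.
exact: definable_iff (definable_forall 2 dimp).
Qed.

(** The selection is the lexicographic minimum of the fibre.  Each coordinate is a
    bounded function whose superlevel sets are cut out by a definable predicate, so it
    crosses every level boundedly often and [variation_le] applies. *)
Lemma definable_selection F (B : R) :
  definable R k.+1 (fun e => F (e 0%N 0 0) (e 1%N)) ->
  (forall t, compact (F t)) -> (forall t v, F t v -> `|v| <= B) ->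
  exists (gamma : R -> 'rV[R]_k.+1) (L : R),
    (forall t, F t !=set0 ->
       F t (gamma t) /\ forall v, F t v -> gamma t 0 0 <= v 0 0) /\
    (forall t : nat -> R, (forall i, t i.+1 <= t i) -> (forall i, F (t i) !=set0) ->
       forall K, \sum_(i < K) `|gamma (t i.+1) - gamma (t i)| <= L).
Proof.
move=> dF cF bF.
pose gamma t := get (lexmin k.+1 (F t)).
have gammaP t : F t !=set0 -> lexmin k.+1 (F t) (gamma t).
  move=> F0; have [_ [v Lv]] := lexmin_compact k.+1 (cF t) F0.
  exact: (@getI _ (lexmin k.+1 (F t)) v).
have Fgamma t : F t !=set0 -> F t (gamma t).
  by move=> /gammaP; exact: (@lexmin_sub 0).
pose above (i : 'I_k.+1) t s := exists v, lexmin k.+1 (F t) v /\ s < v 0 i.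
have aboveE i t s : F t !=set0 -> `[< above i t s >] = (s < gamma t 0 i).
  move=> /gammaP Lg; apply/asboolP/idP => [[v [Lv]]|]; last by exists (gamma t).
  by rewrite (lexmin_coord i Lv Lg).
have sw i : exists M, forall s, switches_at_most M (fun t => `[< above i t s >]).
  apply: definable_switches.
  have dand : definable R k.+1 (fun e => lexmin k.+1 (F (e 0%N 0 0)) (e 2%N) /\
      e 1%N 0 0 < e 2%N 0 i).
    apply: definable_and; last by apply: definable_lt; exact: polynomial_coord.
    exact/(@definable_rename (fun t => lexmin k.+1 (F t)))/definable_lexmin.
  exact: definable_iff (definable_exists 2 dand).
have [M hM] := choice sw.
exists gamma, (\sum_(i < k.+1) (M i).*2%:R * (B - - B)); split.
  move=> t F0; split; first exact: Fgamma.
  move=> v Fv; have := lexmin_sub (ltn0Sn k) (gammaP t F0).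
  have -> : (0 : 'I_k.+1) = inord 0 by apply: val_inj; rewrite /= inordK.
  by move=> /= [_]; exact.
move=> t tdec F0 K.
have norm_le (v : 'rV[R]_k.+1) : `|v| <= \sum_(i < k.+1) `|v 0 i|.
  rewrite [leLHS]mx_normrE; apply/bigmax_leP; split; first exact: sumr_ge0.
  move=> [i j] _ /=; rewrite ord1 (bigD1 j) //= lerDl; exact: sumr_ge0.
apply: (@le_trans _ _ (\sum_(j < K) \sum_(i < k.+1)
    `|gamma (t j.+1) 0 i - gamma (t j) 0 i|)).
  apply: ler_sum => j _; apply: le_trans (norm_le _) _.
  by apply: ler_sum => i _; rewrite !mxE.
rewrite exchange_big /=; apply: ler_sum => i _.
apply: (@variation_le _ _ (fun j => gamma (t j) 0 i)).
  move=> j; have := bF _ _ (Fgamma _ (F0 j)); rewrite -ler_norml; apply: le_trans.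
  rewrite [leRHS]mx_normrE; exact: (le_bigmax _ _ (ord0, i)).
move=> s; apply: leq_trans (count_switches_le K (hM i s) tdec).
by apply: leq_sum => j _; rewrite !aboveE.
Qed.

End selection.

(** * Polynomial functions: derivative, growth, critical points *)

Section polynomial_functions.
Context (R : realType) (n : nat).
Implicit Types (f : mpoly.mpoly n R) (x y u v : 'rV[R]_n) (X : set 'rV[R]_n).

Lemma differentiable_polyfun f x : differentiable (polyfun f) x.
Proof.
have -> : polyfun f = fun y => \sum_(m <- mpoly.msupp f)
    mpoly.mcoeff m f * \prod_(i < n) y 0 i ^+ m i.
  by apply: funext => y; rewrite /polyfun mpoly.mevalE.
elim: (mpoly.msupp f) => [|m s IH].
  by under eq_fun do rewrite big_nil; exact: differentiable_cst.
under eq_fun do rewrite big_cons; apply: differentiableD => //.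
apply: (@differentiableZ _ _ _ (fun y => \prod_(i < n) y 0 i ^+ m i)).
elim: (index_enum 'I_n) => [|i r IHr].
  by under eq_fun do rewrite big_nil; exact: differentiable_cst.
under eq_fun do rewrite big_cons; apply: (@differentiableM _ _ (fun y => y 0 i ^+ m i)) => //.
elim: (m i) => [|k IHk]; first by under eq_fun do rewrite expr0; exact: differentiable_cst.
under eq_fun do rewrite exprS; apply: (@differentiableM _ _ (fun y : 'rV[R]_n => y 0 i)) => //.
exact: differentiable_coord.
Qed.

Lemma continuous_polyfun f : continuous (polyfun f).
Proof. by move=> x; exact/differentiable_continuous/differentiable_polyfun. Qed.

Lemma derive_polyfun f x v : 'D_v (polyfun f) x = dot (grad (polyfun f) x) v.
Proof.
have df := differentiable_polyfun f x.
rewrite deriveE // {1}[v]matrix_sum_delta zmodp.big_ord1 linear_sum.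
by apply: eq_bigr => i _; rewrite linearZ /= mxE deriveE // mulrC.
Qed.

Lemma coord_le_norm x i : `|x 0 i| <= `|x|.
Proof. rewrite [leRHS]mx_normrE; exact: (le_bigmax _ _ (ord0, i)). Qed.

Lemma dot_le u v : dot u v <= n%:R * (`|u| * `|v|).
Proof.
apply: le_trans (ler_norm _) _; apply: le_trans (ler_norm_sum _ _ _) _.
apply: (@le_trans _ _ (\sum_(i < n) `|u| * `|v|)).
  by apply: ler_sum => i _; rewrite normrM ler_pM ?coord_le_norm.
by rewrite sumr_const card_ord mulr_natl.
Qed.

Lemma norm_sqr_le_dot x : `|x| ^+ 2 <= dot x x.
Proof.
have dot_ge i : `|x 0 i| ^+ 2 <= dot x x.
  rewrite /dot (bigD1 i) //= -expr2 real_normK ?num_real // lerDl.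
  by apply: sumr_ge0 => j _; rewrite -expr2 sqr_ge0.
rewrite -[leRHS]sqr_sqrtr; last by apply: sumr_ge0 => i _; rewrite -expr2 sqr_ge0.
rewrite ler_sqr ?nnegrE ?sqrtr_ge0 //.
rewrite [leLHS]mx_normrE; apply/bigmax_leP; split; first exact: sqrtr_ge0.
move=> [i j] _ /=; rewrite ord1 -(ler_sqr (normr_ge0 _)) ?nnegrE ?sqrtr_ge0 //.
by rewrite sqr_sqrtr //; apply: le_trans (dot_ge j); rewrite sqr_ge0.
Qed.

Lemma dot_ge0 x : 0 <= dot x x.
Proof. exact: le_trans (sqr_ge0 _) (norm_sqr_le_dot x). Qed.

Lemma enorm_sqr x : enorm x ^+ 2 = dot x x.
Proof. by rewrite sqr_sqrtr // dot_ge0. Qed.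

Lemma norm_le_enorm x : `|x| <= enorm x.
Proof.
by rewrite -ler_sqr ?nnegrE ?sqrtr_ge0 // enorm_sqr norm_sqr_le_dot.
Qed.

(** On the sphere of radius [e] the leading form is at least [c0 * e ^ d.+1] by
    homogeneity, while the other monomials contribute at most [S * e ^ d], where [S] is
    the sum of the absolute values of the coefficients. *)
Lemma polyfun_coercive f d : mpoly.msize f = d.+2 ->
  0 < inf_sphere (polyfun (leading_form f)) ->
  forall c, exists B, forall x, polyfun f x <= c -> `|x| <= B.
Proof.
move=> szf lead0 c; set c0 := inf_sphere _ in lead0.
have lead_ge u : enorm u = 1 -> c0 <= polyfun (leading_form f) u.
  move=> u1; apply: ge_inf; last by exists u.
  (* Without a lower bound the infimum would be the default value 0. *)
  have [[]//|noinf] :=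
    pselect (has_inf [set polyfun (leading_form f) x | x in [set x | enorm x = 1]]).
  by move: lead0; rewrite /c0 /inf_sphere inf_out // ltxx.
pose S := \sum_(m <- mpoly.msupp f) `|mpoly.mcoeff m f|.
exists (Num.max 1 ((S + `|c|) / c0)) => x fx.
apply: le_trans (norm_le_enorm x) _; rewrite leNgt; apply/negP.
rewrite gt_max => /andP[e1 eS]; set e := enorm x in e1 eS.
have e0 : 0 < e by exact: lt_trans e1.
pose u := e^-1 *: x.
have u1 : enorm u = 1.
  rewrite /enorm; have -> : dot u u = e ^- 2 * dot x x.
    rewrite /dot mulr_sumr; apply: eq_bigr => i _; rewrite !mxE; field.
    by rewrite gt_eqF.
  by rewrite -enorm_sqr -/e mulVf ?sqrtr1 // expf_neq0 // gt_eqF.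
pose mono m (w : 'rV[R]_n) : R := \prod_(i < n) w 0 i ^+ (m : mpoly.multinom n) i.
have monoE m : mono m x = e ^+ mpoly.mdeg m * mono m u.
  rewrite mpoly.mdegE -prodrXr -big_split /=; apply: eq_bigr => i _.
  by rewrite mxE exprMn mulrA -exprMn divff ?gt_eqF // expr1n mul1r.
have mono_le1 m : `|mono m u| <= 1.
  rewrite normr_prod; apply: prodr_ile1 => i; rewrite normr_ge0 /= normrX.
  move=> _; apply: exprn_ile1 => //; rewrite -u1.
  exact: le_trans (coord_le_norm u i) (norm_le_enorm u).
have lead_u : polyfun (leading_form f) u =
    \sum_(m <- mpoly.msupp f | mpoly.mdeg m == d.+1) mpoly.mcoeff m f * mono m u.
  rewrite /polyfun /leading_form mpoly.pihomogE szf raddf_sum /=.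
  by apply: eq_bigr => m _; rewrite mpoly.mevalZ mpoly.mevalX.
have f_x : polyfun f x = e ^+ d.+1 * polyfun (leading_form f) u +
    \sum_(m <- mpoly.msupp f | mpoly.mdeg m != d.+1) mpoly.mcoeff m f * mono m x.
  rewrite /polyfun mpoly.mevalE -/(polyfun _ _) (bigID (fun m => mpoly.mdeg m == d.+1)) /=.
  congr (_ + _); rewrite [X in _ * X]lead_u mulr_sumr; apply: eq_bigr => m /eqP md.
  by rewrite -/(mono m x) monoE md mulrCA.
have rest : - (S * e ^+ d) <=
    \sum_(m <- mpoly.msupp f | mpoly.mdeg m != d.+1) mpoly.mcoeff m f * mono m x.
  rewrite lerNl -sumrN /S mulr_suml.
  rewrite [leRHS](bigID (fun m => mpoly.mdeg m == d.+1)) /= -[leLHS]add0r lerD //.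
    by apply: sumr_ge0 => m _; rewrite mulr_ge0 // exprn_ge0 // ltW.
  rewrite !(big_seq_cond (fun m => mpoly.mdeg m != d.+1)); apply: ler_sum => m /andP[ms md].
  apply: le_trans (ler_norm _) _; rewrite normrN normrM ler_wpM2l // monoE normrM.
  rewrite -[leRHS]mulr1 ler_pM // ger0_norm ?exprn_ge0 ?(ltW e0) //.
  apply: ler_weXn2l; first exact: ltW.
  by have := mpoly.msize_mdeg_lt ms; rewrite szf ltnS leq_eqVlt (negbTE md).
suff : polyfun f x > `|c| by rewrite ltNge (le_trans fx) // ler_norm.
rewrite f_x; apply: lt_le_trans (lerD (lexx _) rest).
have ed1 : 1 <= e ^+ d by rewrite exprn_ege1 // ltW.
have lu := lead_ge _ u1.
have eS' : S + `|c| < c0 * e by rewrite mulrC -ltr_pdivrMr.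
have : e ^+ d * (c0 * e - S) <= e ^+ d.+1 * polyfun (leading_form f) u - S * e ^+ d.
  rewrite exprS -subr_ge0.
  have -> : e * e ^+ d * polyfun (leading_form f) u - S * e ^+ d - e ^+ d * (c0 * e - S)
     = e * e ^+ d * (polyfun (leading_form f) u - c0) by ring.
  by rewrite !mulr_ge0 ?subr_ge0 // ?exprn_ge0 // ltW.
apply: lt_le_trans; apply: lt_le_trans (_ : c0 * e - S <= _); first by lra.
by rewrite ler_peMl // subr_ge0; have := normr_ge0 c; lra.
Qed.

(** Along the segment from [a] to [x], the difference quotient at [a] is at least
    [- C * h * |x - a|^2], which tends to 0 with [h]. *)
Lemma lower_critical_of_quadratic X f a C : convex_set X -> X a ->
  (forall x, X x -> polyfun f a - C * dot (x - a) (x - a) <= polyfun f x) ->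
  lower_critical X (polyfun f) a.
Proof.
move=> cX Xa quad; split => // x Xx; rewrite -derive_polyfun.
set v := x - a.
have Xseg h : 0 < h -> h <= 1 -> X (h *: v + a).
  move=> h0 h1; have := cX x a (Itv01 (ltW h0) h1).
  rewrite !inE => /(_ Xx Xa); congr X.
  rewrite -[LHS]/(h *: x + (1 - h) *: a : 'rV[R]_n) /v.
  by rewrite scalerBl scale1r scalerBr -!addrA [- _ + a]addrC.
pose quot h := h^-1 *: ((polyfun f \o shift a) (h *: v) - polyfun f a).
have quotD : (fun h => quot h + C * h * dot v v) @ 0^'+ --> 'D_v (polyfun f) a.
  rewrite -[X in _ --> X]addr0; apply: cvgD.
    have : quot @ 0^' --> 'D_v (polyfun f) a.
      exact: (@diff_derivable _ _ _ (polyfun f) a v (differentiable_polyfun f a)).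
    apply: cvg_trans; apply: cvg_app => A A0.
    apply: (@filterS _ (nbhs (0 : R)) _ (fun h => h != 0 -> A h) (fun h => 0 < h -> A h) _ A0).
    by move=> h Ah h0; apply: Ah; rewrite gt_eqF.
  rewrite -[X in _ --> X](mul0r (dot v v)) -[X in X * _](mulr0 C).
  apply: cvgMl; apply: cvgMr; apply: cvg_at_right_filter; exact: cvg_id.
apply: (cvgr_to_ge quotD); near=> h.
have h0 : 0 < h by near: h; exact: nbhs_right_gt.
have h1 : h <= 1 by near: h; exact: nbhs_right_le.
have := quad _ (Xseg h h0 h1).
have -> : h *: v + a - a = h *: v by rewrite addrK.
have -> : dot (h *: v) (h *: v) = h ^+ 2 * dot v v.
  by rewrite /dot mulr_sumr; apply: eq_bigr => i _; rewrite !mxE; ring.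
rewrite -subr_ge0 => ineq; rewrite /quot /=.
have -> : h^-1 *: (polyfun f (h *: v + a) - polyfun f a) + C * h * dot v v =
   h^-1 * (polyfun f (h *: v + a) - (polyfun f a - C * (h ^+ 2 * dot v v))).
  by rewrite /GRing.scale /=; field; rewrite gt_eqF.
by rewrite mulr_ge0 // invr_ge0 ltW.
Unshelve. all: by end_near. Qed.

End polynomial_functions.

(** * Sequences of finite length *)

(** This declares the join of the norm and of the completeness of matrices, on which
    the convergence of absolutely convergent series rests. *)
HB.instance Definition _ (R : realType) m n := Complete.on 'M[R]_(m, n).

Section convergence.
Context (R : realType).

(** Summing the recursion, half of the sum of the [D i] is absorbed by the left-hand
    side. *)
Lemma sum_le_of_halving (D G : nat -> R) (c L : R) : 0 <= c ->
  (forall i, 0 <= D i) ->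
  (forall i, D i.+1 <= D i / 2 + c * G i) ->
  (forall K, \sum_(i < K) G i <= L) ->
  forall K, \sum_(i < K) D i <= 2 * (D 0%N + c * L).
Proof.
move=> c0 D0 Dstep GL K.
have SS : \sum_(i < K) D i <= \sum_(i < K.+1) D i by rewrite big_ord_recr /= lerDl.
have : \sum_(i < K.+1) D i <= D 0%N + (\sum_(i < K) D i) / 2 + c * L.
  rewrite big_ord_recl /= -addrA lerD2l.
  apply: le_trans (_ : \sum_(i < K) (D i / 2 + c * G i) <= _).
    by apply: ler_sum => i _; exact: Dstep.
  by rewrite big_split /= -mulr_suml -mulr_sumr lerD2l ler_wpM2l ?GL.
move: SS; lra.
Qed.

Lemma cvg_of_finite_length n (a : nat -> 'rV[R]_n) (L : R) :
  (forall K, \sum_(i < K) `|a i.+1 - a i| <= L) -> cvgn a.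
Proof.
move=> aL; pose u := fun i => a i.+1 - a i.
have : cvgn (series u).
  apply: (@normed_cvg R 'rV[R]_n u); apply: nondecreasing_is_cvgn.
    by apply: nondecreasing_series => i _ _; exact: normr_ge0.
  by exists L => _ [K _ <-]; have := aL K; rewrite -(big_mkord xpredT (fun i => `|u i|)).
have seriesE : series u = (fun K => a K - a 0%N).
  by apply: funext => K; rewrite /series /= telescope_sumr ?leq0n.
rewrite seriesE => cu.
have -> : a = (fun K => (a K - a 0%N) + a 0%N) by apply: funext => K; rewrite subrK.
by apply: is_cvgD => //; exact: is_cvg_cst.
Qed.

End convergence.

(** * The proximal step *)

Section proximal_step.
Context (R : realType) (n : nat) (X : set 'rV[R]_n) (f : mpoly.mpoly n R).
Implicit Types (x y p xi : 'rV[R]_n).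

Lemma cvg_dot (T : Type) (F : set_system T) {FF : Filter F} (u v : T -> 'rV[R]_n) x y :
  u @ F --> x -> v @ F --> y -> (fun t => dot (u t) (v t)) @ F --> dot x y.
Proof.
move=> ux vy; rewrite /dot; elim: (index_enum 'I_n) => [|i s IH].
  by under eq_fun do rewrite big_nil; rewrite big_nil; exact: cvg_cst.
under eq_fun do rewrite big_cons; rewrite big_cons; apply: cvgD => //; apply: cvgM.
  exact: (cvg_comp _ _ ux (@coord_continuous _ _ _ 0 i x)).
exact: (cvg_comp _ _ vy (@coord_continuous _ _ _ 0 i y)).
Qed.

(** What is kept of the minimality of [p] for the objective centred at [xi]: unlike the
    objective itself, this inequality is polynomial. *)
Definition proximal (N : R) xi p :=
  X p /\ forall x, X x ->
    polyfun f p * (1 - N * (2 * dot (p - xi) (x - p) + dot (x - p) (x - p))) <= polyfun f x.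

(** A minimum exists because the objective is at least [m * N * |x - xi|^2] on [X].  At
    the minimum [q] the ratio of the exponential factors is [expR (- (N * s))], which is
    at least [1 - N * s]. *)
Lemma argmin_proximal (N m : R) xi : closed X -> X xi -> 0 < N -> 0 < m ->
  (forall x, X x -> m <= polyfun f x) ->
  proximal N xi (argmin X (exp_conv N xi f)).
Proof.
move=> cX Xxi N0 m0 fm; set phi := exp_conv N xi f.
have phiE x : phi x = expR (N * dot (x - xi) (x - xi)) * polyfun f x.
  by rewrite /phi /exp_conv enorm_sqr.
have cphi (x : 'rV[R]_n) : phi @ x --> phi x.
  have -> : phi = fun x => expR (N * dot (x - xi) (x - xi)) * polyfun f x by apply: funext.
  have cB : (fun y => y - xi) @ x --> x - xi.
    by apply: (@cvgB _ _ _ (nbhs x) _ id (fun=> xi) x xi); [exact: cvg_id|exact: cvg_cst].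
  have cdot : (fun y => N * dot (y - xi) (y - xi)) @ x --> N * dot (x - xi) (x - xi).
    exact: (@cvgMr _ _ (nbhs x) _ _ _ _ (cvg_dot cB cB)).
  have cexp := @continuous_cvg _ _ _ _ _ _ _ _ (@continuous_expR R _) cdot.
  exact: (@cvgM _ _ (nbhs x) _ _ _ _ _ (cexp _) (@continuous_polyfun _ _ f x)).
pose K := X `&` [set x | phi x <= phi xi].
have K0 : K !=set0 by exists xi; split => //=.
have cK : compact K.
  apply: bounded_closed_compact; last first.
    by apply: closedI => //; apply: closed_comp (@closed_le _ _) => x _; exact: cphi.
  exists (1 + phi xi / (m * N) + `|xi|); split; first exact: num_real.
  move=> M ltM x [Xx /= phix]; apply: le_trans (ltW ltM).
  have : m * (N * `|x - xi| ^+ 2) <= phi xi.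
    apply: le_trans phix; rewrite phiE [leRHS]mulrC; apply: ler_pM.
    - exact: ltW.
    - by rewrite mulr_ge0 ?sqr_ge0 // ltW.
    - exact: fm.
    apply: le_trans (expR_ge1Dx _); rewrite -[leLHS]add0r lerD // ler_wpM2l ?(ltW N0) //.
    exact: norm_sqr_le_dot.
  rewrite mulrA -ler_pdivlMl ?mulr_gt0 // [leRHS]mulrC => le_sqr.
  have := sqr_ge0 (`|x - xi| - 1); have := ler_normD (x - xi) xi; rewrite subrK.
  nra.
have [p] := EVT_min_rV K0 cK (continuous_subspaceT cphi).
rewrite inE => -[Xp phip] pmin.
have p_min : X p /\ forall x, X x -> phi p <= phi x.
  split => // x Xx; have [xle|xgt] := leP (phi x) (phi xi); first by apply: pmin; rewrite inE.
  exact: le_trans phip (ltW xgt).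
have [] := @getI _ [set a | X a /\ forall x, X x -> phi a <= phi x] p p_min.
rewrite -/(argmin X phi); set q := argmin X phi => Xq qmin.
split=> // x Xx; have := qmin x Xx; rewrite !phiE => le_qx.
have fq0 : 0 < polyfun f q by apply: lt_le_trans (fm _ Xq).
set s := 2 * _ + _.
have dotE : dot (x - xi) (x - xi) = dot (q - xi) (q - xi) + s.
  rewrite /s /dot !mulr_sumr -!big_split /=; apply: eq_bigr => i _; rewrite !mxE; ring.
have : polyfun f q * expR (- (N * s)) <= polyfun f x.
  rewrite -(ler_pM2l (expR_gt0 (N * dot (x - xi) (x - xi)))) (le_trans _ le_qx) //.
  have -> : expR (N * dot (q - xi) (q - xi)) = expR (N * dot (x - xi) (x - xi)) * expR (- (N * s)).
    by rewrite -expRD dotE; congr expR; ring.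
  by rewrite -mulrA [polyfun f q * _]mulrC.
apply: le_trans; rewrite ler_wpM2l ?(ltW fq0) //.
exact: expR_ge1Dx.
Qed.

End proximal_step.

(** * Points of least slope on a level of the function *)

Section slope.
Context (R : realType) (n : nat) (X : set 'rV[R]_n) (f : mpoly.mpoly n R).
Context (C c0 rmax B : R).
Implicit Types (x y : 'rV[R]_n) (r t : R) (v w : 'rV[R]_n.+1).

(** At [x] the function [f] decreases along [X] at rate at most [r], up to a quadratic
    error that is uniform in [x].  No gradient or normal cone is involved, so that the
    condition is closed in [(x, r)] and definable. *)
Definition slope_le x r : Prop :=
  forall y, X y -> polyfun f x - polyfun f y <= r * `|y - x| + C * `|y - x| ^+ 2.

(** A vector of dimension [n.+1] stands for a pair (slope, point), the slope being the
    coordinate 0: the lexicographic minimum then minimises the slope first. *)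
Definition pair_point v : 'rV[R]_n := \row_i v 0 (lift ord0 i).

Definition cons_point r x : 'rV[R]_n.+1 :=
  \row_j (if unlift ord0 j is Some i then x 0 i else r).

Lemma cons_point0 r x : cons_point r x 0 0 = r.
Proof. by rewrite mxE unlift_none. Qed.

Lemma cons_pointK r x : pair_point (cons_point r x) = x.
Proof. by apply/rowP => i; rewrite !mxE liftK. Qed.

Lemma norm_le_of_coords k (x : 'rV[R]_k) b : 0 <= b -> (forall i, `|x 0 i| <= b) -> `|x| <= b.
Proof.
move=> b0 xb; rewrite [leLHS]mx_normrE; apply/bigmax_leP; split => //.
by move=> [i j] _ /=; rewrite ord1.
Qed.

Lemma pair_point_lipschitz v w : `|pair_point v - pair_point w| <= `|v - w|.
Proof.
apply: norm_le_of_coords => // i.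
by have := coord_le_norm (v - w) (lift ord0 i); rewrite !mxE.
Qed.

Lemma continuous_pair_point : continuous pair_point.
Proof.
suff H (v : 'rV[R]_n.+1) : pair_point @ v --> pair_point v by exact: H.
apply: (proj2 (@cvgrPdist_le _ _ _ (nbhs v) _ pair_point (pair_point v))) => e e0; near=> w.
apply: le_trans (pair_point_lipschitz v w) _; near: w.
exact: (@cvgr_dist_le _ _ _ (nbhs v) _ id v (@cvg_id _ (nbhs v)) e e0).
Unshelve. all: by end_near. Qed.

(** The bounds [c0] on the values and [rmax] on the slopes keep these sets in one compact
    set, whatever [t]. *)
Definition level_slopes t : set 'rV[R]_n.+1 :=
  [set v | [/\ X (pair_point v), polyfun f (pair_point v) = t, t <= c0,
     0 <= v 0 0 <= rmax & slope_le (pair_point v) (v 0 0)]].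

(** The norm is not polynomial: the slope condition is expressed by quantifying over a
    pair [(rho, y)] with [|y_i - x_i| <= rho] for all [i].  Since [v 0 0] and [C] are
    nonnegative, the best such [rho] is the distance itself. *)
Lemma definable_level_slopes : semialgebraic X -> 0 <= C ->
  definable R n.+1 (fun e => level_slopes (e 0%N 0 0) (e 1%N)).
Proof.
move=> sX C0.
have ppt j i : polynomial_fn R n.+1 (fun e => pair_point (e j) 0 i).
  by have [T hT] := @polynomial_coord R n.+1 j (lift ord0 i); exists T => s; rewrite hT [RHS]mxE.
have pf j := polynomial_polyfun f (ppt j).
have pX j := definable_semialgebraic sX (ppt j).
have pc j := @polynomial_coord R n.+1 j 0.
have cst := @polynomial_cst R n.+1.
have dclose : definable R n.+1 (fun e => forall i, i \in enum 'I_n ->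
    pair_point (e 2%N) 0 i - pair_point (e 1%N) 0 i <= e 2%N 0 0 /\
    pair_point (e 1%N) 0 i - pair_point (e 2%N) 0 i <= e 2%N 0 0).
  by apply: definable_all => i _; apply: definable_and; apply: definable_le => //;
     exact: polynomialB.
have dineq : definable R n.+1 (fun e => polyfun f (pair_point (e 1%N)) -
    polyfun f (pair_point (e 2%N)) <= e 1%N 0 0 * e 2%N 0 0 + C * e 2%N 0 0 ^+ 2).
  apply: definable_le; first exact: polynomialB.
  apply: polynomialD; first exact: polynomialM.
  by apply: polynomialM => //; exact: polynomialX.
have d0 : definable R n.+1 (fun e => 0 <= e 2%N 0 0) by apply: definable_le.
have dall := definable_forall 2 (definable_imp (pX 2%N)
  (definable_imp d0 (definable_imp dclose dineq))).
have dbox : definable R n.+1 (fun e => 0 <= e 1%N 0 0 /\ e 1%N 0 0 <= rmax).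
  by apply: definable_and; apply: definable_le.
apply: definable_iff (definable_and (pX 1%N) (definable_and
  (definable_eq (pf 1%N) (pc 0%N)) (definable_and
  (definable_le (pc 0%N) (cst c0)) (definable_and dbox dall)))) => e.
rewrite /level_slopes /upd /=; set v := e 1%N.
split=> [[Xv [fv [tc [[v0 vmax] sl]]]]|[Xv fv tc /andP[v0 vmax] sl]].
  split => //; first by rewrite v0.
  move=> y Xy; set rho := `|y - _|.
  have := sl (cons_point rho y); rewrite !cons_pointK !cons_point0.
  apply=> //; first exact: normr_ge0.
  move=> i _; have := coord_le_norm (y - pair_point v) i.
  rewrite !mxE -/rho ler_norml; lra.
split=> //; split => //; split => //; split => // w Xw w0 close.
apply: le_trans (sl _ Xw) _.
have le_w : `|pair_point w - pair_point v| <= w 0 0.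
  apply: norm_le_of_coords => // i; have [] := close i (mem_enum _ i).
  by rewrite !mxE ler_norml => ? ?; apply/andP; split; lra.
by apply: lerD; apply: ler_wpM2l => //; rewrite lerXn2r ?nnegrE.
Qed.

Lemma closed_le_preimage (T : topologicalType) (g h : T -> R) :
  continuous g -> continuous h -> closed [set z | g z <= h z].
Proof.
move=> cg ch.
have -> : [set z | g z <= h z] = (fun z => h z - g z) @^-1` [set u | 0 <= u].
  by apply/seteqP; split=> z /=; rewrite subr_ge0.
apply: closed_comp; last exact: closed_ge.
by move=> z _; apply: cvgB; [exact: ch|exact: cg].
Qed.

Lemma continuous_dist (T : topologicalType) (V : normedModType R) (y : V) (p : T -> V) :
  continuous p -> continuous (fun z => `|y - p z|).
Proof. by move=> cp z; apply: cvg_norm; apply: cvgB; [exact: cvg_cst|exact: cp]. Qed.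

Lemma continuous_slope_bound (T : topologicalType) (g h : T -> R) :
  continuous g -> continuous h -> continuous (fun z => g z * h z + C * h z ^+ 2).
Proof.
move=> cg ch z; under eq_fun do rewrite expr2.
apply: cvgD; first by apply: cvgM; [exact: cg|exact: ch].
by apply: cvgMr; apply: cvgM; exact: ch.
Qed.

Lemma level_slopes_bound t v : (forall x, polyfun f x <= c0 -> `|x| <= B) ->
  level_slopes t v -> `|v| <= `|rmax| + `|B|.
Proof.
move=> fB [_ fv tc /andP[v0 vmax] _].
apply: norm_le_of_coords => [|j]; first by rewrite addr_ge0.
case: (unliftP ord0 j) => [i ->|->].
  have := coord_le_norm (pair_point v) i; rewrite mxE => /le_trans; apply.
  apply: le_trans (fB _ _) _; first by rewrite fv.
  by apply: le_trans (ler_norm _) _; rewrite lerDr.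
rewrite ger0_norm //; apply: le_trans vmax _; apply: le_trans (ler_norm _) _.
by rewrite lerDl.
Qed.

Lemma compact_level_slopes t : closed X ->
  (forall x, polyfun f x <= c0 -> `|x| <= B) -> compact (level_slopes t).
Proof.
move=> cX fB; apply: bounded_closed_compact.
  exists (`|rmax| + `|B|); split; first exact: num_real.
  by move=> M ltM v Fv; apply: le_trans (ltW ltM); exact: level_slopes_bound fB Fv.
have cf : continuous (polyfun f \o pair_point).
  by move=> v; apply: continuous_comp; [exact: continuous_pair_point|exact: continuous_polyfun].
have c0' : continuous (fun v : 'rV[R]_n.+1 => v 0 0) by exact: coord_continuous.
have cst (z : R) : continuous (fun _ : 'rV[R]_n.+1 => z) by move=> v; exact: cst_continuous.
have -> : level_slopes t =
   (pair_point @^-1` X `&` [set v | polyfun f (pair_point v) <= t] `&`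
   [set v | t <= polyfun f (pair_point v)] `&` [set v | t <= c0] `&`
   [set v | 0 <= v 0 0] `&` [set v | v 0 0 <= rmax] `&`
   \bigcap_(y in X) [set v | polyfun f (pair_point v) - polyfun f y <=
      v 0 0 * `|y - pair_point v| + C * `|y - pair_point v| ^+ 2]).
  apply/seteqP; split=> v.
    by move=> [Xv fv tc /andP[v0 vmax] sl]; do !split => //=; rewrite fv.
  move=> /= [[[[[[Xv f1] f2] tc] v0] vmax] sl]; split=> //.
  - by apply/eqP; rewrite eq_le f1 f2.
  - by apply/andP; split; [exact: v0|exact: vmax].
do !apply: closedI.
- by apply: closed_comp => // v _; exact: continuous_pair_point.
- exact: closed_le_preimage.
- exact: closed_le_preimage.
- exact: closed_le_preimage.
- exact: closed_le_preimage.
- exact: closed_le_preimage.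
- apply: closed_bigI => y _; apply: closed_le_preimage.
    by move=> v; apply: (continuousB (cf v)); exact: cst.
  apply: continuous_slope_bound => //; apply: continuous_dist.
  exact: continuous_pair_point.
Qed.

End slope.

(** * Convergence of the proximal iterates *)

Section proximal_sequence.
Context (R : realType) (n : nat) (X : set 'rV[R]_n) (f : mpoly.mpoly n R).
Context (N m : R) (N0 : 0 < N) (m0 : 0 < m).
Implicit Types (x y p xi : 'rV[R]_n).

(** The proximal inequality at [x = xi], where the two scalar products combine into
    [- |p - xi|^2]. *)
Lemma proximal_descent xi p : (forall x, X x -> m <= polyfun f x) -> X xi ->
  proximal X f N xi p ->
  N * polyfun f p * `|p - xi| ^+ 2 <= polyfun f xi - polyfun f p.
Proof.
move=> fm Xxi [Xp /(_ xi Xxi)].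
have -> : 2 * dot (p - xi) (xi - p) + dot (xi - p) (xi - p) = - dot (p - xi) (p - xi).
  rewrite /dot mulr_sumr -sumrN -big_split /=.
  by apply: eq_bigr => i _; rewrite !mxE; ring.
have fp0 : 0 < polyfun f p by apply: lt_le_trans (fm _ Xp).
have : N * polyfun f p * `|p - xi| ^+ 2 <= N * polyfun f p * dot (p - xi) (p - xi).
  by apply: ler_wpM2l; rewrite ?norm_sqr_le_dot // mulr_ge0 ?ltW.
lra.
Qed.

(** In the proximal inequality the cross term [2 <p - xi, y - p>] is at most
    [2 n |p - xi| |y - p|]; the factor [n] compares the scalar product with the maximum
    norm. *)
Lemma proximal_slope c0 xi p : 0 < polyfun f p <= c0 ->
  proximal X f N xi p ->
  slope_le X f (n%:R * N * c0) p (2 * (n%:R * N * c0) * `|p - xi|).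
Proof.
move=> /andP[fp0 fpc] [Xp prox] y Xy.
have := prox y Xy; set s := 2 * _ + _ => le_y.
apply: (@le_trans _ _ (polyfun f p * (N * s))); first by move: le_y; lra.
have s_le : s <= n%:R * (2 * (`|p - xi| * `|y - p|) + `|y - p| ^+ 2).
  have := dot_le (p - xi) (y - p); have := dot_le (y - p) (y - p).
  by rewrite /s expr2; lra.
set b := n%:R * _ in s_le.
have b0 : 0 <= b by rewrite mulr_ge0 // addr_ge0 ?sqr_ge0 // !mulr_ge0.
have -> : 2 * (n%:R * N * c0) * `|p - xi| * `|y - p| + n%:R * N * c0 * `|y - p| ^+ 2
    = c0 * (N * b) by rewrite /b; ring.
apply: (@le_trans _ _ (polyfun f p * (N * b))).
  by apply: ler_wpM2l; [exact: ltW|apply: ler_wpM2l => //; exact: ltW].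
by apply: ler_wpM2r => //; rewrite mulr_ge0 // ltW.
Qed.

(** The constant [2 * kappa + 1] is such that, in the square of the right-hand side, the
    terms in [D * G] and in [G ^+ 2] dominate [2 * kappa * D * G] and [kappa * G ^+ 2]. *)
Lemma step_le_half (kappa D D' G : R) : 0 <= kappa -> 0 <= D -> 0 <= D' -> 0 <= G ->
  D' ^+ 2 <= kappa * (2 * D * G + G ^+ 2) -> D' <= D / 2 + (2 * kappa + 1) * G.
Proof.
move=> k0 D0 D'0 G0 le_sqr.
rewrite -(@ler_sqr R) ?nnegrE ?addr_ge0 ?mulr_ge0 ?invr_ge0 ?addr_ge0 ?mulr_ge0 //.
apply: le_trans le_sqr _; rewrite -subr_ge0.
have -> : (D / 2 + (2 * kappa + 1) * G) ^+ 2 - kappa * (2 * D * G + G ^+ 2) =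
  D ^+ 2 / 4 + D * G + (4 * kappa ^+ 2 + 3 * kappa + 1) * G ^+ 2 by field.
have coef0 : 0 <= 4 * kappa ^+ 2 + 3 * kappa + 1 by have := sqr_ge0 kappa; lra.
have := mulr_ge0 coef0 (sqr_ge0 G); have := mulr_ge0 D0 G0; have := sqr_ge0 D; lra.
Qed.

(** The comparison of two consecutive levels is made at the selected points of least
    slope and not at the iterates: their distances [G nu] are summable, and their slopes
    are at most those of the iterates, which are of order [D nu]. *)
Lemma proximal_finite_length (a : nat -> 'rV[R]_n) :
  closed X -> semialgebraic X ->
  (forall c, exists B, forall x, polyfun f x <= c -> `|x| <= B) ->
  (forall x, X x -> m <= polyfun f x) -> X (a 0%N) ->
  (forall nu, proximal X f N (a nu) (a nu.+1)) ->
  exists L, forall K, \sum_(i < K) `|a i.+1 - a i| <= L.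
Proof.
move=> cX sX coerc fm Xa0 prox.
have Xa nu : X (a nu) by case: nu => // nu; case: (prox nu).
pose t nu := polyfun f (a nu); pose D nu := `|a nu.+1 - a nu|.
have D_ge0 nu : 0 <= D nu by exact: normr_ge0.
have t0 nu : 0 < t nu by apply: lt_le_trans (fm _ (Xa nu)).
have descent nu : N * m * D nu ^+ 2 <= t nu - t nu.+1.
  apply: le_trans (proximal_descent fm (Xa nu) (prox nu)).
  by rewrite ler_wpM2r ?sqr_ge0 // ler_wpM2l ?fm // ltW.
have tdec nu : t nu.+1 <= t nu.
  rewrite -subr_ge0; apply: le_trans (descent nu).
  by rewrite mulr_ge0 ?sqr_ge0 // mulr_ge0 // ltW.
pose c0 := t 0%N.
have tc nu : t nu <= c0 by elim: nu => // nu /(le_trans (tdec nu)).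
have [B fB] := coerc c0.
have aB nu : `|a nu| <= B by apply: fB; exact: tc.
have B0 : 0 <= B by apply: le_trans (aB 0%N).
pose C := n%:R * N * c0.
have C0 : 0 <= C by rewrite mulr_ge0 ?(ltW (t0 0%N)) // mulr_ge0 // ltW.
pose rmax := 2 * C * (B + B).
(* The iterate [a nu.+1] with the slope [r nu] is in the fibre of its own level; the
   first iterate, which is not the result of a step, is left out. *)
pose F := level_slopes X f C c0 rmax.
pose r nu := 2 * C * D nu.
have Fa nu : F (t nu.+1) (cons_point (r nu) (a nu.+1)).
  rewrite /F /level_slopes /= cons_pointK cons_point0; split => //.
  - apply/andP; split; first by rewrite mulr_ge0 ?D_ge0 // mulr_ge0.
    apply: ler_wpM2l; first exact: mulr_ge0.
    by apply: le_trans (ler_normB _ _) _; rewrite lerD.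
  - by apply: proximal_slope => //; rewrite t0 tc.
have [gamma [L [gammaP gammaL]]] := @definable_selection R n F (`|rmax| + `|B|)
  (definable_level_slopes f c0 rmax sX C0)
  (fun u => compact_level_slopes cX fB)
  (fun u v => level_slopes_bound fB).
pose G nu := `|gamma (t nu.+2) - gamma (t nu.+1)|.
have G_ge0 nu : 0 <= G nu by exact: normr_ge0.
have sumG K : \sum_(i < K) G i <= L.
  by apply: (gammaL (fun nu => t nu.+1)) => // nu; exists (cons_point (r nu) (a nu.+1)).
(* Slope condition at the point selected over [t nu.+1], tested at the next one. *)
have drop nu : t nu.+1 - t nu.+2 <= C * (2 * D nu * G nu + G nu ^+ 2).
  have [[_ f1 _ /andP[g0 _] slope] rmin] := gammaP _ (ex_intro _ _ (Fa nu)).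
  have [[X2 f2 _ _ _] _] := gammaP _ (ex_intro _ _ (Fa nu.+1)).
  have := slope _ X2; rewrite f1 f2 => /le_trans; apply.
  set rho := `|_ - _|.
  have rhoG : rho <= G nu by exact: pair_point_lipschitz.
  have gr := rmin _ (Fa nu); rewrite cons_point0 in gr.
  have -> : C * (2 * D nu * G nu + G nu ^+ 2) = r nu * G nu + C * G nu ^+ 2.
    by rewrite /r; ring.
  have rho0 : 0 <= rho by exact: normr_ge0.
  apply: lerD; first exact: ler_pM.
  by apply: ler_wpM2l => //; rewrite lerXn2r ?nnegrE.
pose kappa := C / (N * m).
have kappa0 : 0 <= kappa by rewrite divr_ge0 // mulr_ge0 // ltW.
have Dstep nu : D nu.+1 <= D nu / 2 + (2 * kappa + 1) * G nu.
  apply: step_le_half => //; rewrite /kappa mulrAC ler_pdivlMr ?mulr_gt0 //.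
  by rewrite mulrC; apply: le_trans (descent nu.+1) (drop nu).
exists (2 * (D 0%N + (2 * kappa + 1) * L)).
apply: (@sum_le_of_halving R D G) => //.
by rewrite addr_ge0 // mulr_ge0.
Qed.

(** In the limit the cross term of the proximal inequality vanishes, since the difference
    of consecutive iterates tends to 0. *)
Lemma limit_lower_critical (a : nat -> 'rV[R]_n) (a_star : 'rV[R]_n) :
  convex_set X -> closed X -> (forall nu, X (a nu)) ->
  (forall nu, proximal X f N (a nu) (a nu.+1)) ->
  a @ \oo --> a_star -> lower_critical X (polyfun f) a_star.
Proof.
move=> cvX cX Xa prox a_cvg.
have Xs : X a_star by exact: (@closed_cvg _ _ \oo _ a X cX (nearW _ Xa) a_star a_cvg).
have aS_cvg : (fun nu => a nu.+1) @ \oo --> a_star.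
  by move: a_cvg; rewrite -(cvg_shiftS a).
apply: (@lower_critical_of_quadratic R n X f a_star (N * polyfun f a_star)) => // x Xx.
have f_cvg : (fun nu => polyfun f (a nu.+1)) @ \oo --> polyfun f a_star.
  exact: (@continuous_cvg _ _ _ _ _ _ _ _ (@continuous_polyfun _ _ f a_star) aS_cvg).
have step_cvg : (fun nu => a nu.+1 - a nu) @ \oo --> a_star - a_star.
  exact: cvgB.
have x_cvg : (fun nu => x - a nu.+1) @ \oo --> x - a_star.
  by apply: cvgB => //; exact: cvg_cst.
have rhs_cvg : (fun nu => polyfun f (a nu.+1) *
    (1 - N * (2 * dot (a nu.+1 - a nu) (x - a nu.+1) + dot (x - a nu.+1) (x - a nu.+1))))
  @ \oo --> polyfun f a_star *
    (1 - N * (2 * dot (a_star - a_star) (x - a_star) + dot (x - a_star) (x - a_star))).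
  apply: cvgM => //; apply: cvgB; first exact: cvg_cst.
  apply: cvgMr; apply: cvgD; last exact: cvg_dot.
  by apply: cvgMr; exact: cvg_dot.
have -> : polyfun f a_star - N * polyfun f a_star * dot (x - a_star) (x - a_star) =
    polyfun f a_star *
    (1 - N * (2 * dot (a_star - a_star) (x - a_star) + dot (x - a_star) (x - a_star))).
  have -> : dot (a_star - a_star) (x - a_star) = 0.
    by rewrite /dot big1 // => i _; rewrite !mxE subrr mul0r.
  by ring.
apply: (cvgr_to_le rhs_cvg); apply: nearW => nu.
by have [_ ->] := prox nu.
Qed.

End proximal_sequence.

Theorem theorem6 (R : realType) (n : nat) (X : set 'rV[R]_n)
  (convX : convex_set X) (closedX : closed X) (semialgX : semialgebraic X)
  (f : mpoly.mpoly n R) (d : nat) (d_gt0 : (0 < d)%N)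
  (deg_f : mpoly.msize f = d.+1)
  (lead_gt0 : 0 < inf_sphere (polyfun (leading_form f)))
  (m : R) (m_gt0 : 0 < m) (f_ge_m : forall x, X x -> m <= polyfun f x)
  (N : R) (N_ge1 : 1 <= N)
  (sconv : forall xi : 'rV[R]_n, strongly_convex X (exp_conv N xi f))
  (a : nat -> 'rV[R]_n) (a0X : X (a 0%N))
  (aS : forall nu : nat, a nu.+1 = argmin X (exp_conv N (a nu) f)) :
  exists a_star : 'rV[R]_n,
    a @ \oo --> a_star /\ lower_critical X (polyfun f) a_star.
Proof.
have N_gt0 : 0 < N by exact: lt_le_trans N_ge1.
have aP nu : X (a nu) -> proximal X f N (a nu) (a nu.+1).
  by move=> Xa; rewrite aS; exact: (@argmin_proximal _ _ _ _ _ m).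
have Xa nu : X (a nu) by elim: nu => // nu /aP[].
have prox nu := aP nu (Xa nu).
have coercive : forall c, exists B, forall x, polyfun f x <= c -> `|x| <= B.
  by case: d d_gt0 deg_f => // d _ deg_f; exact: polyfun_coercive deg_f lead_gt0.
have [L lenL] := proximal_finite_length N_gt0 m_gt0
  closedX semialgX coercive f_ge_m a0X prox.
have a_cvg := cvg_of_finite_length lenL.
exists (lim (a @ \oo)); split => //.
exact: (limit_lower_critical convX closedX Xa prox a_cvg).
Qed.
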